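(* Let $Q_+$ be an affine semigroup with $Q=\mathbb{Z}Q_+\cong\mathbb{Z}^d$ and $R=\Bbbk[Q_+]$. For a constructible family $\{M_n\}_{n\in\mathbb{Z}^k}$ of $Q$-modules, a monomial prime ideal $\mathfrak p\subseteq R$, and a linear function $\lambda:Q\to\mathbb{Z}$, the $v$-invariants $v_{\mathfrak p}(\lambda,M_n)$ in direction $\lambda$ are piecewise quasilinear as functions of $n$ (on the set of $n$ where they are defined).
   Context: $\Bbbk$ is a field; an affine semigroup is a finitely generated submonoid with trivial units of a free abelian group; $Q$ is ordered by $q\preceq q'$ iff $q'-q\in Q_+$. Semisimple subset: finite disjoint union of sets $q+N$ with $N$ generated by linearly independent elements. A Presburger group is a partially ordered free abelian group of finite rank whose positive cone is semisimple and generates a finite-index subgroup. A module over a Presburger group $G$ is constructible if its graded pieces are finite-dimensional and $G$ can be partitioned into finitely many semisimple regions $I$ with vector spaces $M_I$ and isomorphisms $M_I\to M_g$ ($g\in I$) such that for $g\in I$, $h\in J$, $g\preceq h$, the composite $M_I\to M_g\to M_h\to M_J$ depends only on $I,J$. A family $\{M_n\}_{n\in\mathbb{Z}^k}$ of $Q$-modules is constructible if for some Presburger group $G=\mathbb{Z}^k\times Q$ with positive cone $G_+$ satisfying $G_+\cap(\{0\}\times Q)=\{0\}\times Q_+$, the direct sum $\bigoplus_nM_n(-n)$ (with $M_n$ in slice $\{n\}\times Q$) is a $G$-graded $\Bbbk[G_+]$-module extending the slice structures and is constructible. For a $Q$-module $M$, the $v$-invariant of $M$ at $\mathfrak p$ in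 direction $\lambda$ is $v_{\mathfrak p}(\lambda,M)=\min\{\langle\lambda,u\rangle\mid \mathfrak p=0:_Rf\text{ for some }f\in M_u\}$. Piecewise quasilinear: there are finitely many rational convex polyhedra covering $\mathbb{Z}^k$ on each of which the function agrees with a function that is affine-linear on each coset of some finite-index sublattice. *)

(* Defs.v *)
From HB Require Import structures.
From mathcomp Require Import all_boot all_order all_algebra.
Set Implicit Arguments. Unset Strict Implicit. Unset Printing Implicit Defensive.
Import Order.TTheory GRing.Theory Num.Theory.
Local Open Scope ring_scope.

Section Semisimple.
Variable T : zmodType.

Definition nspan (gs : seq T) (x : T) : Prop :=
  exists c : nat -> nat, x = \sum_(i < size gs) gs`_i *+ c i.

Definition zindep (gs : seq T) : Prop :=
  forall c : nat -> int, \sum_(i < size gs) gs`_i *~ c i = 0 ->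
    forall i, (i < size gs)%N -> c i = 0.

Definition shifted_span (b : T * seq T) (x : T) : Prop :=
  exists2 y, nspan b.2 y & x = b.1 + y.

Definition semisimple (S : T -> Prop) : Prop :=
  exists blocks : seq (T * seq T),
    [/\ forall i, (i < size blocks)%N -> zindep (nth (0, [::]) blocks i).2,
        forall i j x, (i < size blocks)%N -> (j < size blocks)%N ->
          shifted_span (nth (0, [::]) blocks i) x ->
          shifted_span (nth (0, [::]) blocks j) x -> i = j
      & forall x, S x <-> exists2 i, (i < size blocks)%N &
                                     shifted_span (nth (0, [::]) blocks i) x].

(* Positive cone of a Presburger group structure on T (T free abelian of finite
   rank): it defines a partial order (x <= y iff y - x in C), is semisimple, and
   generates a subgroup of finite index (i.e. containing N*T for some N > 0). *)
Definition presburger_cone (C : T -> Prop) : Prop :=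
  [/\ C 0, (forall x y, C x -> C y -> C (x + y)),
      (forall x, C x -> C (- x) -> x = 0),
      semisimple C
    & exists2 N : nat, (0 < N)%N &
        forall g, exists a b, [/\ C a, C b & g *+ N = a - b]].
End Semisimple.

Section CMod.
Variables (k : fieldType) (T : zmodType) (C : T -> Prop).

(* A T-graded k[C]-module: graded pieces P u, and the action of the monomial
   x^(v-u) (for v - u in C) as a k-linear map P u -> P v. *)
Definition is_cmod (P : T -> lmodType k) (act : forall u v, P u -> P v) : Prop :=
  [/\ forall u v, C (v - u) -> linear (act u v),
      forall u x, act u u x = x
    & forall u v w, C (v - u) -> C (w - v) ->
        forall x, act v w (act u v x) = act u w x].

Record cmod := CMod {
  cpc : T -> lmodType k;
  cact : forall u v, cpc u -> cpc v;
  cmodP : is_cmod cact }.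

Definition findim (V : lmodType k) : Prop :=
  exists s : seq V, forall x : V,
    exists c : nat -> k, x = \sum_(i < size s) c i *: s`_i.

Definition constructible_mod (P : T -> lmodType k)
    (act : forall u v, P u -> P v) : Prop :=
  (forall g, findim (P g)) /\
  exists (nR : nat) (reg : nat -> T -> Prop) (V : nat -> lmodType k)
         (iso : forall i g, V i -> P g),
    [/\ forall i, (i < nR)%N -> semisimple (reg i),
        forall g, exists i, [/\ (i < nR)%N, reg i g &
                   forall j, (j < nR)%N -> reg j g -> j = i],
        forall i g, (i < nR)%N -> reg i g -> linear (iso i g) /\ bijective (iso i g)
      & forall i j, (i < nR)%N -> (j < nR)%N ->
          exists phi : V i -> V j, forall g h, reg i g -> reg j h -> C (h - g) ->
            forall x, act g h (iso i g x) = iso j h (phi x)].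
End CMod.
Arguments cact [k T C] c u v _.

Definition affine_semigroup (d : nat) (Qp : 'rV[int]_d -> Prop) : Prop :=
  [/\ exists gens : seq 'rV[int]_d, forall x, Qp x <-> nspan gens x,
      (forall x, Qp x -> Qp (- x) -> x = 0)
    & forall x, exists a b, [/\ Qp a, Qp b & x = a - b]].

(* A monomial ideal of R = k[Q_+] is described by its set of exponents.
   Monomial prime: proper, ideal, and prime on monomials. *)
Definition monomial_prime (d : nat) (Qp P : 'rV[int]_d -> Prop) : Prop :=
  [/\ forall q, P q -> Qp q,
      forall q a, P q -> Qp a -> P (q + a),
      ~ P 0
    & forall a b, Qp a -> Qp b -> P (a + b) -> P a \/ P b].

Definition ann_exps (k : fieldType) (d : nat) (Qp : 'rV[int]_d -> Prop)
    (M : cmod k Qp) (u : 'rV[int]_d) (f : cpc M u) (q : 'rV[int]_d) : Prop :=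
  Qp q /\ cact M u (u + q) f = 0.

Definition is_vinv (k : fieldType) (d : nat) (Qp : 'rV[int]_d -> Prop)
    (M : cmod k Qp) (P : 'rV[int]_d -> Prop) (lam : 'rV[int]_d -> int) (v : int) : Prop :=
  (exists u (f : cpc M u), (forall q, P q <-> ann_exps f q) /\ lam u = v) /\
  (forall u (f : cpc M u), (forall q, P q <-> ann_exps f q) -> v <= lam u).

Definition constructible_family (k : fieldType) (kk d : nat)
    (Qp : 'rV[int]_d -> Prop) (M : 'rV[int]_kk -> cmod k Qp) : Prop :=
  exists Gp : 'rV[int]_kk * 'rV[int]_d -> Prop,
    [/\ presburger_cone Gp,
        (forall u, Gp (0, u) <-> Qp u)
      & exists ext : forall g h : 'rV[int]_kk * 'rV[int]_d,
                       cpc (M g.1) g.2 -> cpc (M h.1) h.2,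
          [/\ @is_cmod k _ Gp (fun g => cpc (M g.1) g.2) ext,
              (forall n u v, Qp (v - u) -> forall x,
                  ext (n, u) (n, v) x = cact (M n) u v x)
            & @constructible_mod k _ Gp (fun g => cpc (M g.1) g.2) ext]].

Definition in_polyhedron (kk : nat) (ineqs : seq ('rV[int]_kk * int))
    (n : 'rV[int]_kk) : Prop :=
  forall j, (j < size ineqs)%N ->
    \sum_(i < kk) (nth (0, 0) ineqs j).1 ord0 i * n ord0 i <= (nth (0, 0) ineqs j).2.

(* F n v : "the function takes value v at n" (F partial, functional) *)
Definition piecewise_quasilinear (kk : nat) (F : 'rV[int]_kk -> int -> Prop) : Prop :=
  exists polys : seq (seq ('rV[int]_kk * int)),
    (forall n, exists2 i, (i < size polys)%N & in_polyhedron (nth [::] polys i) n) /\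
    (forall i, (i < size polys)%N ->
      exists2 N : nat, (0 < N)%N &
        forall r : 'rV[int]_kk, exists (l : 'rV[rat]_kk) (b : rat),
          forall n v, in_polyhedron (nth [::] polys i) n ->
            (forall j, (N%:Z %| n ord0 j - r ord0 j)%Z) -> F n v ->
            v%:~R = \sum_(j < kk) l ord0 j * (n ord0 j)%:~R + b).

(* Main.v *)
(** Call a subset of a lattice tame when membership is decided by the signs of
    finitely many integral affine forms and by the residue of the point modulo some
    [N]. Tame sets are stable under Boolean operations, affine preimages and (by a
    back-and-forth argument) projections, so every set obtained from semisimple sets
    by first-order constructions is tame. Whether degree [g] of the family has an
    element with annihilator [P] depends only on the region containing [g] and on
    the regions met by the translates of [g] by [P] and by its complementary face,
    so these degrees form a tame set, and hence so does the graph of the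
    v-invariant. Finally, if a tame set is a graph, its value [v] must be pinned
    down by one of finitely many equations [C * v = g n] with [g] affine, and which
    one only depends on the sign pattern (a polyhedron) and the residue of [n]. *)

Require Import Defs.
From HB Require Import structures.
From mathcomp Require Import all_boot all_order all_algebra.
From mathcomp Require Import boolp zify ring.
Import Order.TTheory GRing.Theory Num.Theory.
Local Open Scope ring_scope.

(** * Affine maps between abelian groups *)

(** Preserving [x - y + z] characterises a group morphism plus a constant, without naming either. *)
Definition affine {T U : zmodType} (f : T -> U) : Prop :=
  forall x y z, f (x - y + z) = f x - f y + f z.

Lemma affine_comp {T U V : zmodType} (g : U -> V) (h : T -> U) :
  affine g -> affine h -> affine (fun x => g (h x)).
Proof. by move=> ag ah x y z; rewrite ah ag. Qed.

Lemma morph_affine {T U : zmodType} (f : T -> U) :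
  {morph f : x y / x + y} -> affine f.
Proof.
move=> fD x y z; rewrite fD -[in f x](subrK y x) fD addrK //.
Qed.

(** The difference [f z - f 0] is the linear part of [f] evaluated at [z]. *)
Lemma affineMn {T U : zmodType} (f : T -> U) x z n :
  affine f -> f (x + z *+ n) = f x + (f z - f 0) *+ n.
Proof.
move=> af; elim: n => [|n IHn]; first by rewrite !mulr0n !addr0.
rewrite !mulrSr [RHS]addrA -IHn addrA -[x + z *+ n + z]/(x + z *+ n + z).
by rewrite -{1}[x + _]subr0 af addrAC addrA.
Qed.

Lemma affineMz {T U : zmodType} (f : T -> U) x z m :
  affine f -> f (x + z *~ m) = f x + (f z - f 0) *~ m.
Proof.
move=> af; case: m => n; first by rewrite -!pmulrn affineMn.
rewrite NegzE !mulrNz -!pmulrn.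
by rewrite -[in RHS](subrK (z *+ n.+1) x) affineMn // addrK.
Qed.

Lemma affine_sum_delta m (f : 'rV[int]_m -> int) x :
  affine f -> f x = \sum_j (f (delta_mx 0 j) - f 0) * x 0 j + f 0.
Proof.
move=> af; rewrite {1}[x]row_sum_delta.
elim/big_rec2: _ => [|j u y _ IH]; first by rewrite add0r.
by rewrite addrC -[x 0 j in X in f X]intz scaler_int affineMz // IH mulrzz addrC addrA.
Qed.

(** * Tame sets and Boolean operations *)

Definition equisigned {T : zmodType} {I : finType} (f : I -> T -> int) (N : nat)
    (x y : T) : Prop :=
  (forall i, (0 <= f i x) = (0 <= f i y)) /\ exists z, y = x + z *+ N.

(** One implication suffices, since [equisigned] is symmetric. *)
Definition tame {T : zmodType} (S : T -> Prop) : Prop :=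
  exists (I : finType) (f : I -> T -> int) (N : nat),
    [/\ (0 < N)%N, forall i, affine (f i)
      & forall x y, equisigned f N x y -> S x -> S y].

Lemma equisigned_sym {T : zmodType} {I : finType} (f : I -> T -> int) N x y :
  equisigned f N x y -> equisigned f N y x.
Proof.
move=> [s [z yE]]; split=> [i|]; first by rewrite s.
by exists (- z); rewrite yE mulNrn addrK.
Qed.

Lemma tame_preim {T U : zmodType} (h : T -> U) (S : U -> Prop) :
  affine h -> tame S -> tame (fun x => S (h x)).
Proof.
move=> ah [I [f [N [N0 af fS]]]]; exists I, (fun i x => f i (h x)), N.
split=> // [i|x y [s [z yE]]]; first exact: affine_comp.
by apply: fS; split=> //; exists (h z - h 0); rewrite yE affineMn.
Qed.

(** The disjoint union of the forms and the product of the moduli serve all [R i] at once. This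
    covers every Boolean combination. *)
Lemma tame_determined {T : zmodType} (m : nat) (R : nat -> T -> Prop) (S : T -> Prop) :
  (forall i, (i < m)%N -> tame (R i)) ->
  (forall x y, (forall i, (i < m)%N -> R i x <-> R i y) -> S x -> S y) -> tame S.
Proof.
move=> tR dS.
suff [I [f [N [N0 af fR]]]] : exists (I : finType) (f : I -> T -> int) (N : nat),
    [/\ (0 < N)%N, forall i, affine (f i)
      & forall x y, equisigned f N x y -> forall i, (i < m)%N -> R i x -> R i y].
  exists I, f, N; split=> // x y exy; apply: dS => i im.
  by split; apply: fR => //; apply: equisigned_sym.
elim: m tR {dS} => [_|m IHm tR].
  by exists void, (fun _ _ => 0), 1%N; split.
have [i im|I [f [N [N0 af fR]]]] := IHm; first exact/tR/ltnW.
have [J [g [K [K0 ag gR]]]] := tR m (leqnn _).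
exists (I + J)%type, (fun t => match t with inl i => f i | inr j => g j end), (N * K)%N.
split=> [|[i|j]//|x y [s [z yE]] i]; first by rewrite muln_gt0 N0.
rewrite ltnS leq_eqVlt => /orP[/eqP->|im].
  apply: gR; split=> [j|]; first exact: (s (inr j)).
  by exists (z *+ N); rewrite yE mulrnA.
apply: fR im; split=> [j|]; first exact: (s (inl j)).
by exists (z *+ K); rewrite yE mulnC mulrnA.
Qed.

Lemma tame_and {T : zmodType} (R S : T -> Prop) :
  tame R -> tame S -> tame (fun x => R x /\ S x).
Proof.
move=> tR tS; apply: (@tame_determined _ 2 (fun i => if i is 0%N then R else S)).
  by case.
by move=> x y E [/(E 0%N isT) + /(E 1%N isT)].
Qed.

Lemma tame_not {T : zmodType} (R : T -> Prop) : tame R -> tame (fun x => ~ R x).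
Proof.
move=> tR; apply: (@tame_determined _ 1 (fun=> R)) => // x y E nR.
by move/(E 0%N isT).
Qed.

Lemma tame_ge0 {T : zmodType} (f : T -> int) : affine f -> tame (fun x => 0 <= f x).
Proof.
move=> af; exists unit, (fun=> f), 1%N; split=> // x y [s _].
by rewrite (s tt).
Qed.

Lemma tame_eqP {T : zmodType} (R S : T -> Prop) :
  (forall x, R x <-> S x) -> tame R -> tame S.
Proof.
by move=> E tR; apply: (@tame_determined _ 1 (fun=> R)) => // x y /(_ 0%N isT) xy /E/xy/E.
Qed.

(** * Projections of tame sets *)

(* All coefficients of the last coordinate are scaled to a common value [C], and
   the inequalities bounding it from below are negated, so that they all read
   [C * v <= b i x]. *)
Lemma tame_last_coordinate {T : zmodType} (S : T * int -> Prop) :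
  tame S -> exists (I : finType) (a b : I -> T -> int) (N C : nat),
    [/\ (0 < N)%N /\ (0 < C)%N, forall i, affine (a i), forall i, affine (b i)
      & forall x y v w, equisigned a N x y ->
          (forall i, (C%:Z * v <= b i x) = (C%:Z * w <= b i y)) ->
          (exists z, w = v + z *+ N) -> S (x, v) -> S (y, w)].
Proof.
move=> [I [f [N [N0 af fS]]]].
pose c i : int := f i (0, 1) - f i (0, 0).
pose C := (\prod_(i | c i != 0) `|c i|)%N.
(* If [c i = 0], division by zero gives [e i = 0]. This is harmless: the form then ignores [v], and
   the sign of [a i] decides. *)
pose e i : int := (C %/ `|c i|)%N.
pose a i x := f i (x, 0).
pose b i x := if 0 < c i then - e i * a i x - 1 else e i * a i x.
have aa i : affine (a i).
  by apply: affine_comp => // x y z; congr pair; rewrite subr0 addr0.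
have fE i x v : f i (x, v) = a i x + c i * v.
  have -> : (x, v) = (x, 0) + (0, 1) *~ v :> T * int.
    by apply/eqP; rewrite xpair_eqE /= !raddfMz /= mul0rz intz addr0 add0r !eqxx.
  by rewrite affineMz // mulrzz.
exists I, a, b, N, C; split=> //.
- by split=> //; rewrite prodn_cond_gt0 // => i; rewrite absz_gt0.
- move=> i x y z; rewrite /b; case: ifP => _; rewrite aa; ring.
move=> x y v w [sa [z yE]] sb [t wE]; apply: fS; split=> [i|]; last first.
  by exists (z, t); rewrite yE wE pairMnE.
have {sa sb} := (sa i, sb i).
rewrite !fE /b; have [ci0|ci0] := eqVneq (c i) 0; first by rewrite ci0 !mul0r !addr0 => -[].
have CE : C%:Z = e i * `|c i|.
  by rewrite /e -abszE -PoszM divnK // /C (bigD1 i) //= dvdn_mulr.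
have e0 : 0 < e i.
  have : (0 < C)%N by rewrite prodn_cond_gt0 // => j; rewrite absz_gt0.
  rewrite -ltz_nat CE; nia.
rewrite CE => -[_]; case: ifP => c0.
  rewrite gtr0_norm // => H; apply: negb_inj; move: H.
  have E u s : (e i * c i * s <= - e i * u - 1) = ~~ (0 <= u + c i * s).
    by nia.
  by rewrite !E.
have E u s : (e i * `|c i| * s <= e i * u) = (0 <= u + c i * s).
  by rewrite ler0_norm ?leNgt ?c0 //; nia.
by rewrite !E.
Qed.

(* Moving [v] down by multiples of [N] does not affect membership until [C * v]
   gets within [C * N] of a lower bound [b t x]; the point reached then is
   determined by [b t x] and a bounded offset, hence can be copied to [y]. *)
Lemma tame_fiber {T : zmodType} (S : T * int -> Prop) :
  tame S -> exists (I : finType) (f : I -> T -> int) (N C : nat),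
    [/\ (0 < N)%N /\ (0 < C)%N, forall i, affine (f i)
      & forall x v, S (x, v) ->
          (forall y, equisigned f N x y -> exists w, S (y, w)) /\
          ((exists2 v', v' <> v & S (x, v')) \/
           exists2 g : T -> int, affine g &
             C%:Z * v = g x /\
             forall y, equisigned f N x y -> exists2 w, C%:Z * w = g y & S (y, w))].
Proof.
move=> /tame_last_coordinate [I [a [b [N [C [[N0 C0] aa ab abS]]]]]].
(* At a point with [C * v = b t x + e.+1], the sign of the second kind of form tells whether
   [C * v <= b i x]. Modulo [C * N], each [b t] moves by multiples of [C * N], so this equation
   stays solvable after passing to [y]. *)
pose f (k : I + I * I * 'I_(C * N)) x :=
  match k with inl i => a i x | inr (i, t, e) => b i x - b t x - e.+1%:Z end.
exists (I + I * I * 'I_(C * N))%type, f, (C * N)%N, C; split=> //.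
- by rewrite muln_gt0 C0.
- move=> [i|[[i t] e]]; first exact: aa.
  by move=> x y z; rewrite /= !ab; ring.
have fa x y : equisigned f (C * N) x y -> equisigned a N x y.
  move=> [s [z yE]]; split=> [i|]; first exact: (s (inl i)).
  by exists (z *+ C); rewrite yE mulrnA.
have a_refl x : equisigned a N x x by split=> //; exists 0; rewrite mul0rn addr0.
move=> x v Sxv.
(* Without a lower bound, [v] can be lowered indefinitely; [m] below is large enough to pass under
   every [b i y]. *)
case: (pickP (fun i => b i x < C%:Z * v)) => [t0 bt0|nb]; last first.
  have vb i : C%:Z * v <= b i x by rewrite leNgt nb.
  split=> [y xy|]; last first.
    left; exists (v - N%:Z); first lia.
    apply: abS Sxv => [//|i|]; last by exists (-1); rewrite mulNrn natz.
    by rewrite vb; symmetry; apply: le_trans (vb i); nia.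
  pose m := (\sum_i `|(b i y - C%:Z * v)%R|)%N.
  exists (v - (N * m)%:Z); apply: (abS _ _ _ _ (fa _ _ xy)) Sxv => [i|].
    rewrite vb; symmetry.
    have : (`|(b i y - C%:Z * v)%R| <= m)%N by rewrite /m (bigD1 i) //= leq_addr.
    move: (b i y) m => B m Bm; have : (m <= C * (N * m))%N.
      by rewrite mulnA leq_pmull // muln_gt0 C0.
    by rewrite mulrBr -PoszM; lia.
  by exists (- m%:Z); rewrite mulNrn -mulr_natr natz mulrC.
case: (@arg_maxP _ _ _ t0 (fun i => b i x < C%:Z * v) (b^~ x) bt0) => t bt bmax {t0 bt0}.
(* The shift by 1 puts the offset [e.+1] of [v0] between 1 and [C * N], so [C * v0] stays strictly
   above [b t x], the largest lower bound. *)
pose D := C%:Z * v - b t x - 1; pose j := (D %/ (C * N)%N)%Z.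
have [e De] : exists e : 'I_(C * N), (D %% (C * N)%N)%Z = e.
  have CN0 : (0 < C * N)%N by rewrite muln_gt0 C0.
  have d0 : 0 <= (D %% (C * N)%N)%Z by apply: modz_ge0; lia.
  have d1 : (D %% (C * N)%N)%Z < (C * N)%N by apply: ltz_pmod; lia.
  have lt : (`|(D %% (C * N)%N)%Z| < C * N)%N by lia.
  by exists (Ordinal lt); rewrite /= gez0_abs.
pose v0 := v - j * N%:Z.
have v0E : C%:Z * v0 = b t x + e.+1%:Z.
  have := divz_eq D (C * N)%N; rewrite -/j De /v0 /D.
  by rewrite PoszM; nia.
have j0 : 0 <= j by rewrite divz_ge0; [rewrite /D|]; nia.
have Sxv0 : S (x, v0).
  apply: abS Sxv => [//|i|]; last first.
    by exists (- j); rewrite /v0 mulNrn -mulr_natr natz.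
  apply/idP/idP => [|v0b]; first by apply: le_trans; rewrite /v0; nia.
  by rewrite leNgt; apply/negP => /bmax; lia.
have lift y : equisigned f (C * N) x y -> exists2 w, C%:Z * w = b t y + e.+1%:Z & S (y, w).
  move=> xy; have [s [z yE]] := xy.
  pose k := b t z - b t 0.
  have btE : b t y = b t x + k * (C * N)%N%:Z by rewrite yE affineMn // -mulr_natr natz.
  have wE : C%:Z * (v0 + k * N%:Z) = b t y + e.+1%:Z.
    by rewrite btE mulrDr v0E PoszM; ring.
  exists (v0 + k * N%:Z) => //.
  apply: (abS _ _ _ _ (fa _ _ xy)) Sxv0 => [i|]; last by exists k; rewrite -mulr_natr natz.
  by have := s (inr (i, t, e)); rewrite /= wE v0E; lia.
split=> [y /lift[w _]|]; first by exists w.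
(* Either [v0] is a second point of the fibre, or [v] itself satisfies the equation given by [t] and
   [e]. *)
have [<-|ne] := eqVneq v0 v; last by left; exists v0 => //; apply/eqP.
right; exists (fun x => b t x + e.+1%:Z) => // x' y z; rewrite ab; ring.
Qed.

Lemma tame_ex_int {T : zmodType} (S : T * int -> Prop) :
  tame S -> tame (fun x => exists v, S (x, v)).
Proof.
move=> /tame_fiber [I [f [N [C [[N0 _] af fS]]]]]; exists I, f, N; split=> // x y xy [v].
by move=> /fS[/(_ y xy)].
Qed.

(** The coordinates of [u] are eliminated one at a time by [tame_ex_int]. *)
Lemma tame_ex_row {T : zmodType} d (S : T * 'rV[int]_d -> Prop) :
  tame S -> tame (fun x => exists u, S (x, u)).
Proof.
elim: d S => [|d IHd] S tS.
  apply: (@tame_eqP _ (fun x => S (x, 0))) => [x|].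
    by split=> [|[u]]; [exists 0 | rewrite [u]thinmx0].
  by apply: tame_preim tS => x y z; congr pair; rewrite [RHS]thinmx0.
pose h (p : T * 'rV[int]_d * int) : T * 'rV[int]_(1 + d) :=
  (p.1.1, row_mx (const_mx p.2) p.1.2).
apply: (@tame_eqP _ (fun x => exists u, exists v, S (h (x, u, v)))) => [x|].
  split=> [[u [v Suv]]|[u Su]]; first by exists (h (x, u, v)).2.
  exists (rsubmx (u : 'rV_(1 + d))), (u 0 0); rewrite /h /=.
  have <- : lsubmx (u : 'rV_(1 + d)) = const_mx (u 0 0).
    by apply/rowP => i; rewrite !mxE ord1; congr (u _ _); apply: val_inj.
  by rewrite hsubmxK.
apply: (IHd (fun p => exists v, S (h (p, v)))).
apply: (@tame_ex_int _ (fun q => S (h q))); apply: tame_preim tS => -[[x u] v] [[x' u'] v'] [[x'' u''] v''].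
rewrite /h /=; congr pair.
by apply/rowP => j; rewrite !mxE /=; case: (split (j : 'I_(1 + d))) => i; rewrite !mxE.
Qed.

(** * Tameness of comparisons, finite quantifiers and semisimple sets *)

Lemma tame_le {T : zmodType} (f g : T -> int) :
  affine f -> affine g -> tame (fun x => f x <= g x).
Proof.
move=> af ag; apply: (@tame_eqP _ (fun x => 0 <= g x - f x)) => [x|].
  by rewrite subr_ge0.
by apply: tame_ge0 => x y z; rewrite af ag; ring.
Qed.

Lemma tame_eq {T : zmodType} (f g : T -> int) :
  affine f -> affine g -> tame (fun x => f x = g x).
Proof.
move=> af ag; apply: (@tame_eqP _ (fun x => f x <= g x /\ g x <= f x)) => [x|].
  by split=> [[fg gf]|->]; [apply/le_anti; rewrite fg|].
by apply: tame_and; apply: tame_le.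
Qed.

Lemma tame_all {T : zmodType} (m : nat) (R : nat -> T -> Prop) :
  (forall i, (i < m)%N -> tame (R i)) -> tame (fun x => forall i, (i < m)%N -> R i x).
Proof. by move=> tR; apply: tame_determined tR _ => x y E Rx i im; apply/E/Rx. Qed.

Lemma tame_ex {T : zmodType} (m : nat) (R : nat -> T -> Prop) :
  (forall i, (i < m)%N -> tame (R i)) -> tame (fun x => exists2 i, (i < m)%N & R i x).
Proof.
by move=> tR; apply: tame_determined tR _ => x y E [i im Rix]; exists i => //; apply/E.
Qed.

Lemma tame_row0 d : tame (fun x : 'rV[int]_d => x = 0).
Proof.
have ac (j : 'I_d) : affine (fun x : 'rV[int]_d => x 0 j) by move=> x y z; rewrite !mxE.
apply: (@tame_eqP _ (fun x : 'rV[int]_d =>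
  forall i, (i < d)%N -> forall j : 'I_d, j = i :> nat -> x 0 j = 0)) => [x|].
  split=> [x0|-> i _ j _]; last by rewrite mxE.
  by apply/rowP => j; rewrite mxE; apply: (x0 j).
apply: tame_all => i id.
apply: (@tame_eqP _ (fun x : 'rV[int]_d => x 0 (Ordinal id) = 0)) => [x|].
  split=> [x0 j ji|/(_ (Ordinal id) erefl)//].
  by rewrite (_ : j = Ordinal id) //; apply: val_inj.
by apply: tame_eq => // x y z; rewrite subrr addr0.
Qed.

Lemma tame_pair0 {T U : zmodType} :
  tame (fun x : T => x = 0) -> tame (fun x : U => x = 0) -> tame (fun x : T * U => x = 0).
Proof.
move=> tT tU; apply: (@tame_eqP _ (fun x : T * U => x.1 = 0 /\ x.2 = 0)) => [[x y]|].
  by split=> [[/= -> ->]|[-> ->]].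
by apply: tame_and; [apply: (@tame_preim _ _ fst) tT | apply: (@tame_preim _ _ snd) tU].
Qed.

Lemma nspan0 {T : zmodType} (gs : seq T) : nspan gs 0.
Proof. by exists (fun=> 0%N); rewrite big1. Qed.

Lemma nspan_nil {T : zmodType} (x : T) : nspan [::] x <-> x = 0.
Proof.
by split=> [[c ->]|->]; rewrite ?big_ord0 //; exists (fun=> 0%N); rewrite big_ord0.
Qed.

Lemma nspan_cons {T : zmodType} (g : T) gs x :
  nspan (g :: gs) x <-> exists n : nat, nspan gs (x - g *+ n).
Proof.
split=> [[c ->]|[n [c E]]].
  by exists (c 0%N), (fun i => c i.+1); rewrite big_ord_recl /= addrAC subrr add0r.
exists (fun i => if i is i'.+1 then c i' else n).
by rewrite big_ord_recl /= -E addrC subrK.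
Qed.

(** The multiplicity of each generator is a nonnegative integer variable, removed by projection. *)
Lemma tame_nspan {T : zmodType} (gs : seq T) :
  tame (fun x : T => x = 0) -> tame (nspan gs).
Proof.
move=> t0; elim: gs => [|g gs IHgs].
  by apply: tame_eqP t0 => x; rewrite nspan_nil.
apply: (@tame_eqP _ (fun x => exists v : int, 0 <= v /\ nspan gs (x - g *~ v))) => [x|].
  rewrite nspan_cons; split=> [[[n|n] [] // _ ?]|[n ?]]; first by exists n.
  by exists n%:Z.
apply: (@tame_ex_int _ (fun p => 0 <= p.2 /\ nspan gs (p.1 - g *~ p.2))).
apply: tame_and; first exact: tame_ge0.
apply: (@tame_preim _ _ (fun p : T * int => p.1 - g *~ p.2)) IHgs => -[x v] [x' v'] [x'' v''].
by apply: (@morph_affine _ _ (fun p : T * int => p.1 - g *~ p.2)) => -[y w] [z t] /=;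
  rewrite mulrzDr opprD addrACA.
Qed.

Lemma tame_semisimple {T : zmodType} (S : T -> Prop) :
  tame (fun x : T => x = 0) -> semisimple S -> tame S.
Proof.
move=> t0 [bs [_ _ SE]]; apply: tame_eqP (fun x => iff_sym (SE x)) _ => {S SE}.
apply: tame_ex => i _; case: (nth _ bs i) => q gs.
apply: (@tame_eqP _ (fun x => nspan gs (x - q))) => [x|].
  split=> [?|[y /= yn ->]]; last by rewrite addrC addKr.
  by exists (x - q); rewrite // addrC subrK.
apply: (@tame_preim _ _ (fun x => x - q)) (tame_nspan gs t0) => x y z.
by rewrite opprB !addrA subrK.
Qed.

(** * Monomial primes and annihilators *)

(** The generators outside [P] work: a sum with a summand in [P] lies in [P] by the ideal property,
    and primality keeps sums of elements outside [P] outside. *)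
Lemma monomial_prime_face d (Qp P : 'rV[int]_d -> Prop) (gens : seq 'rV[int]_d) :
  (forall x, Qp x <-> nspan gens x) -> monomial_prime Qp P ->
  exists fgens : seq 'rV[int]_d, forall x, Qp x /\ ~ P x <-> nspan fgens x.
Proof.
move=> QE [PQ Pideal P0 Pprime]; exists [seq g <- gens | ~~ `[< P g >]].
have Q0 : Qp 0 by apply/QE/nspan0.
have QD x y : Qp x -> Qp y -> Qp (x + y).
  move=> /QE[a ->] /QE[b ->]; apply/QE; exists (fun i => a i + b i)%N.
  by rewrite -big_split /=; apply: eq_bigr => i _; rewrite mulrnDr.
have QMn g n : Qp g -> Qp (g *+ n).
  by move=> Qg; elim: n => [|n IHn] //; rewrite mulrS; apply: QD.
have PMn g n : Qp g -> P (g *+ n) -> P g.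
  move=> Qg; elim: n => [|n IHn] //; rewrite mulrS.
  by move=> /(Pprime _ _ Qg (QMn _ _ Qg))[|/IHn].
(* Only this inclusion passes to sublists of [gens], so the induction runs with it in place of the
   equivalence. *)
have : forall x, nspan gens x -> Qp x by move=> x /QE.
move=> sQ x; have -> : Qp x /\ ~ P x <-> nspan gens x /\ ~ P x by rewrite QE.
elim: gens {QE} sQ x => [|g gs IHgs] sQ x.
  by rewrite /= nspan_nil; split=> [[]|->].
have sQ' y : nspan gs y -> Qp y.
  by move=> gy; apply/sQ/nspan_cons; exists 0%N; rewrite subr0.
have Qg : Qp g.
  by apply/sQ/nspan_cons; exists 1%N; rewrite subrr; apply: nspan0.
rewrite nspan_cons /=; case: asboolP => /= Pg.
  rewrite -IHgs //; split=> [[[[|n] gx] nPx]|[gx nPx]].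
  - by rewrite subr0 in gx.
  - case: nPx; rewrite -(subrK (g *+ n.+1) x) addrC {1}mulrS -addrA.
    by apply: Pideal => //; apply: QD; [apply: QMn | apply: sQ'].
  - by split=> //; exists 0%N; rewrite subr0.
rewrite nspan_cons; split=> [[[n gx] nPx]|[n /(IHgs sQ')[gx nPx]]].
  exists n; apply/(IHgs sQ'); split=> // Px; apply: nPx.
  by rewrite -(subrK (g *+ n) x); apply: Pideal => //; apply: QMn.
split; first by exists n.
by rewrite -(subrK (g *+ n) x) => /(Pprime _ _ (sQ' _ gx) (QMn _ _ Qg))[|/(PMn _ _ Qg)].
Qed.

(* Whether the annihilator of an element of a constructible module is [P] is read
   off from its class in [V i] and from the regions met by the translates of its
   degree by [P] and by the complementary face. *)
Lemma tame_prime_annihilator (k : fieldType) (d kk : nat) (Qp : 'rV[int]_d -> Prop)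
    (M : 'rV[int]_kk -> cmod k Qp) (P : 'rV[int]_d -> Prop) :
  affine_semigroup Qp -> constructible_family M -> monomial_prime Qp P ->
  tame (fun g : 'rV[int]_kk * 'rV[int]_d =>
    exists f : cpc (M g.1) g.2, forall q, P q <-> ann_exps f q).
Proof.
move=> [[gens QE] _ _] [Gp [_ GpQ [ext [_ extE [_ [nR [reg [V [iso [regS regU isoP phiP]]]]]]]]]] HP.
have [fgens FE] := monomial_prime_face _ _ _ _ QE HP.
have [PQ _ _ _] := HP.
have t0 : tame (fun x : 'rV[int]_kk * 'rV[int]_d => x = 0).
  by apply: tame_pair0; apply: tame_row0.
have tQ : tame Qp.
  by apply: tame_eqP (fun x => iff_sym (QE x)) _; apply: tame_nspan; apply: tame_row0.
have tF : tame (fun q => Qp q /\ ~ P q).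
  by apply: tame_eqP (fun x => iff_sym (FE x)) _; apply: tame_nspan; apply: tame_row0.
have tP : tame P.
  apply: (@tame_eqP _ (fun q => Qp q /\ ~ (Qp q /\ ~ P q))) => [q|].
    split=> [[Qq nFq]|Pq]; first by apply: contrapT => nPq; apply: nFq.
    by split=> [|[]]; first exact: PQ.
  by apply: tame_and => //; apply: tame_not.
pose meets X j (g : 'rV[int]_kk * 'rV[int]_d) := exists q, X q /\ reg j (g.1, g.2 + q).
have t_meets X j : (j < nR)%N -> tame X -> tame (meets X j).
  move=> jn tX; apply: (@tame_ex_row _ _ (fun p => X p.2 /\ reg j (p.1.1, p.1.2 + p.2))).
  apply: tame_and; first exact: (@tame_preim _ _ snd).
  apply: (@tame_preim _ _ (fun p : _ * _ * _ => (p.1.1, p.1.2 + p.2))).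
    by apply: morph_affine => -[[a b] c] [[a' b'] c']; congr pair; rewrite /= addrACA.
  by apply: tame_semisimple => //; apply: regS.
(* Three conditions per region [j], indexed by [3 * j + r]. *)
pose R t g := match t %% 3 with
  | 0 => reg (t %/ 3) g
  | 1 => meets P (t %/ 3) g
  | _ => meets (fun q => Qp q /\ ~ P q) (t %/ 3) g
  end%N.
apply: (@tame_determined _ (nR * 3) R) => [t|].
  rewrite -ltn_divLR // => tn; rewrite /R; case: (t %% 3)%N => [|[|_]].
  - by apply: tame_semisimple => //; apply: regS.
  - exact: t_meets.
  - exact: t_meets.
move=> [n u] [m w] xyR.
have xyR' j r : (j < nR)%N -> (r < 3)%N -> R (j * 3 + r)%N (n, u) <-> R (j * 3 + r)%N (m, w).
  by move=> jn r3; apply: xyR; lia.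
have xyreg j : (j < nR)%N -> reg j (n, u) <-> reg j (m, w).
  by move=> jn; move: (xyR' j 0%N jn isT); rewrite /R modnMDl divnMDl // addn0.
have xyP j : (j < nR)%N -> meets P j (n, u) <-> meets P j (m, w).
  by move=> jn; move: (xyR' j 1%N jn isT); rewrite /R modnMDl divnMDl // addn0.
have xyF j : (j < nR)%N -> meets (fun q => Qp q /\ ~ P q) j (n, u) <->
    meets (fun q => Qp q /\ ~ P q) j (m, w).
  by move=> jn; move: (xyR' j 2%N jn isT); rewrite /R modnMDl divnMDl // addn0.
have iso0 i g : (i < nR)%N -> reg i g -> iso i g 0 = 0.
  move=> lt_i /(isoP i g lt_i)[li _].
  by have := li (-1) 0 0; rewrite !scaleN1r !addNr.
(* Whether the monomial of exponent [q] kills [iso i g v] depends only on [v] and the region of the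
   target degree, because [iso] is injective there. *)
have act_iso i j phi g q v : (i < nR)%N -> (j < nR)%N -> reg i g ->
    (forall g h, reg i g -> reg j h -> Gp (h - g) ->
      forall x, ext g h (iso i g x) = iso j h (phi x)) ->
    Qp q -> reg j (g.1, g.2 + q) ->
    cact (M g.1) g.2 (g.2 + q) (iso i g v) = 0 <-> phi v = 0.
  case: g => a b /= lt_i lt_j ig phiE Qq jg.
  have Qb : Qp (b + q - b) by rewrite addrC addKr.
  rewrite -extE // (phiE (a, b) (a, b + q)) //; last first.
    by rewrite -[X in Gp X]/(a - a, b + q - b) subrr [b + q]addrC addrK; apply/GpQ.
  split=> [|->]; last exact: (iso0 j (a, b + q) lt_j jg).
  have [_ /bij_inj inj] := isoP j _ lt_j jg.
  by rewrite -(iso0 j _ lt_j jg) => /inj.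
move=> [f fP].
have [i [lt_i xi _]] := regU (n, u).
have yi := (xyreg i lt_i).1 xi.
have [_ [inv _ invK]] := isoP i _ lt_i xi.
rewrite -(invK f) in fP; move: {f} (inv f) fP => v fP.
exists (iso i (m, w) v) => q.
have [Qq|nQq] := pselect (Qp q); last by split=> [/PQ|[]].
have [j [lt_j yj _]] := regU (m, w + q).
have [phi phiE] := phiP i j lt_i lt_j.
have yE := act_iso i j phi (m, w) q v lt_i lt_j yi phiE Qq yj.
have [Pq|nPq] := pselect (P q).
  (* Some [p] in [P], possibly other than [q], moves [(n, u)] into the same region [j]; the common
     map [phi] transfers the vanishing. *)
  have /(xyP j lt_j)[p [Pp xj]] : meets P j (m, w) by exists q.
  split=> // _; split=> //; apply/yE.
  by apply/(act_iso i j phi (n, u) p v lt_i lt_j xi phiE (PQ _ Pp) xj); case: ((fP p).1 Pp).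
have /(xyF j lt_j)[p [[Qp_p nPp] xj]] : meets (fun q => Qp q /\ ~ P q) j (m, w) by exists q.
split=> // -[_ /yE phi0]; case: nPp; apply/fP; split=> //.
exact/(act_iso i j phi (n, u) p v lt_i lt_j xi phiE Qp_p xj).
Qed.

(** * From tame graphs to piecewise quasilinear functions *)

Lemma piecewise_of_tame kk (F : 'rV[int]_kk -> int -> Prop) :
  tame (fun p : 'rV[int]_kk * int => F p.1 p.2) ->
  (forall n v w, F n v -> F n w -> v = w) -> piecewise_quasilinear F.
Proof.
move=> /tame_fiber [I [f [N [C [[N0 C0] af fF]]]]] Ffun.
pose coef i : 'rV[int]_kk := \row_j (f i (delta_mx 0 j) - f i 0).
(* One polyhedron per sign pattern [s]; by integrality, a negative form is at most -1. *)
pose ineq (s : {ffun I -> bool}) i :=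
  if s i then (- coef i, f i 0) else (coef i, - f i 0 - 1).
have polyE s n : in_polyhedron [seq ineq s i | i <- enum I] n <->
    forall i, s i = (0 <= f i n).
  have ineqE i : \sum_(j < kk) (ineq s i).1 ord0 j * n ord0 j <= (ineq s i).2
      <-> s i = (0 <= f i n).
    pose L := \sum_j (f i (delta_mx 0 j) - f i 0) * n 0 j.
    have -> : f i n = L + f i 0 by apply: affine_sum_delta.
    rewrite /ineq; case: ifP => si /=.
      rewrite (_ : \sum_(j < kk) _ = - L); last first.
        by rewrite /L -sumrN; apply: eq_bigr => j _; rewrite !mxE mulNr.
      lia.
    rewrite (_ : \sum_(j < kk) _ = L); last by apply: eq_bigr => j _; rewrite !mxE.
    by lia.
  split=> [ns i|ns j].
    have lt_i : (index i (enum I) < size (enum I))%N by rewrite index_mem mem_enum.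
    apply/ineqE; have := ns (index i (enum I)).
    by rewrite size_map => /(_ lt_i); rewrite (nth_map i) // nth_index ?mem_enum.
  rewrite size_map => lt_j.
  have i0 : I by case: (enum I) lt_j.
  by rewrite (nth_map i0) //; apply/ineqE.
exists [seq [seq ineq s i | i <- enum I] | s <- enum {ffun I -> bool}].
split=> [n|t].
  pose s := [ffun i => 0 <= f i n].
  exists (index s (enum {ffun I -> bool})); first by rewrite size_map index_mem mem_enum.
  rewrite (nth_map s) ?index_mem ?mem_enum // nth_index ?mem_enum //.
  by apply/polyE => i; rewrite ffunE.
rewrite size_map => lt_t; exists N => // r.
pose s0 : {ffun I -> bool} := [ffun=> true].
rewrite (nth_map s0) //; move: (nth s0 _ t) => s {t lt_t}.
pose cls n := in_polyhedron [seq ineq s i | i <- enum I] n /\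
  forall j, (N%:Z %| n ord0 j - r ord0 j)%Z.
(* A single defined value in the class fixes the formula; if there is none, any formula will do. *)
have [[n0 [v0 [[pn0 rn0] F0]]]|nF] := pselect (exists n v, cls n /\ F n v); last first.
  by exists 0, 0 => n v pn rn Fnv; case: nF; exists n, v.
(* Functionality of [F] excludes a second point in the fibre, leaving the equation [C * v = g n]. *)
have [_ [[v' ne /(Ffun _ _ _ F0)/esym//]|[g ag [_ gF]]]] := fF n0 v0 F0.
exists (\row_j ((g (delta_mx 0 j) - g 0)%:~R / C%:R)), ((g 0)%:~R / C%:R) => n v pn rn Fnv.
have /gF[w wE /(Ffun _ _ _ Fnv) vw] : equisigned f N n0 n.
  split=> [i|]; first by rewrite -(polyE s n0).1 // -(polyE s n).1.
  exists (\row_j ((n ord0 j - n0 ord0 j) %/ N)%Z); apply/rowP => j.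
  have Nd : (N%:Z %| n ord0 j - n0 ord0 j)%Z.
    rewrite (_ : _ - _ = (n ord0 j - r ord0 j) - (n0 ord0 j - r ord0 j)); last by ring.
    by rewrite rpredB // ?rn ?rn0.
  rewrite [RHS]mxE mulmxnE mxE -mulr_natr natz (divzK Nd).
  by rewrite addrC subrK.
have C0' : C%:R != 0 :> rat by rewrite pnatr_eq0 -lt0n.
apply: (mulfI C0'); rewrite vw; move/(congr1 (fun z : int => z%:~R : rat)): wE.
rewrite intrM => ->; rewrite affine_sum_delta // intrD rmorph_sum mulrDr mulr_sumr /=.
congr (_ + _); last by rewrite mulrC divfK.
by apply: eq_bigr => j _; rewrite intrM mxE; field.
Qed.

Theorem theorem9p27 (k : fieldType) (d kk : nat) (Qp : 'rV[int]_d -> Prop)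
    (HQ : affine_semigroup Qp)
    (M : 'rV[int]_kk -> cmod k Qp) (HM : constructible_family M)
    (P : 'rV[int]_d -> Prop) (HP : monomial_prime Qp P)
    (lam : 'rV[int]_d -> int) (Hlam : forall x y, lam (x + y) = lam x + lam y) :
  piecewise_quasilinear (fun n v => is_vinv (M n) P lam v).
Proof.
have tD := tame_prime_annihilator _ _ _ _ _ _ HQ HM HP.
set D := (D in tame D) in tD.
have al : affine lam by apply: morph_affine.
apply: piecewise_of_tame; last first.
  move=> n v w [[u [f [fP uv]]] vmin] [[u' [f' [f'P uw]]] wmin].
  by apply/le_anti/andP; split; [rewrite -uw; apply: vmin f'P | rewrite -uv; apply: wmin fP].
have tDpair : tame (fun p : 'rV[int]_kk * int * 'rV[int]_d => D (p.1.1, p.2)).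
  exact: (@tame_preim _ _ (fun p : 'rV[int]_kk * int * 'rV[int]_d => (p.1.1, p.2))).
(* Being the minimum is restated as attainment together with the absence of a smaller value, two
   conditions accessible to projection and complement. *)
apply: (@tame_eqP _ (fun p : 'rV[int]_kk * int =>
  (exists u, D (p.1, u) /\ lam u = p.2) /\
  ~ exists u, D (p.1, u) /\ ~ (p.2 <= lam u))) => [[n v]|].
  rewrite /is_vinv /=; split=> -[[u uD] vmin]; split.
  - by case: uD => -[f fP] uv; exists u, f.
  - move=> u' f' f'P; apply: contrapT => nle; apply: vmin; exists u'; split=> //.
    by exists f'.
  - by case: uD => f [fP uv]; exists u; split=> //; exists f.
  - by move=> [u' [[f' f'P]]]; apply; apply: vmin f'P.
apply: tame_and; last apply: tame_not.
  apply: (@tame_ex_row _ _ (fun p : 'rV[int]_kk * int * 'rV[int]_d =>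
    D (p.1.1, p.2) /\ lam p.2 = p.1.2)).
  by apply: tame_and => //; apply: tame_eq => // x y z; apply: al.
apply: (@tame_ex_row _ _ (fun p : 'rV[int]_kk * int * 'rV[int]_d =>
  D (p.1.1, p.2) /\ ~ (p.1.2 <= lam p.2))).
by apply: tame_and => //; apply: tame_not; apply: tame_le => // x y z; apply: al.
Qed.
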